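(* Let $n\ge 2$, let $\Omega\subset\mathbb{R}^n$ be a bounded domain and let $0\le\gamma<3$. There exists a universal constant $c_0>0$ (that is, depending only on $n$, $\gamma$ and $\Omega$) such that the following holds. If $u\in C(\Omega)$ is a nonnegative viscosity solution to $\mathcal{L}^{\gamma}_\infty u=0$ in $\Omega$ and $X_0\in\overline{\{u>0\}}\cap\Omega$, then $$\sup_{B_r(X_0)}u\ \ge\ c_0\, r^{\frac{4}{3-\gamma}}\qquad\text{for all } 0<r<\mathrm{dist}(X_0,\partial\Omega).$$
   Context: The infinity Laplacian is $\Delta_\infty u:=\sum_{i,j}\partial_i u\,\partial_{ij}u\,\partial_j u=(Du)^T D^2u\,Du$. Write $v^+=\max(v,0)$ and $\mathcal{L}^{\gamma}_\infty v:=\Delta_\infty v-(v^+)^\gamma$; for $\gamma=0$ the term $(v^+)^0$ is read as $1$ where $v>0$ and $0$ where $v\le 0$. A continuous function $u:\Omega\to\mathbb{R}$ is a viscosity subsolution of $\mathcal{L}^{\gamma}_\infty u=0$ in $\Omega$ (written $\mathcal{L}^\gamma_\infty u\ge 0$) if whenever $\varphi\in C^2$ and $u-\varphi$ has a local maximum at $Y\in\Omega$, then $\Delta_\infty\varphi(Y)-(u(Y)^+)^\gamma\ge 0$; it is a viscosity supersolution (written $\mathcal{L}^\gamma_\infty u\le 0$) if whenever $\varphi\in C^2$ and $\varphi-u$ has a local maximum at $Y\in\Omega$, then $\Delta_\infty\varphi(Y)-(u(Y)^+)^\gamma\le 0$. A viscosity solution is both. $B_r(X_0)$ is the open ball of radius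 $r$ centered at $X_0$. *)

(* Defs.v *)
From HB Require Import structures.
From mathcomp Require Import all_boot all_order all_algebra.
From mathcomp Require Import all_classical all_reals all_analysis.

Set Implicit Arguments.
Unset Strict Implicit.
Unset Printing Implicit Defensive.

Import Order.TTheory GRing.Theory Num.Theory.
Import numFieldNormedType.Exports.

Local Open Scope classical_set_scope.
Local Open Scope ring_scope.

(* The library norm on row vectors is the sup norm: it induces the usual
   topology and the usual bounded sets of R^n, but not the round balls nor the
   Euclidean distance, hence the definitions below. *)
Definition enorm (R : realType) (n : nat) (x : 'rV[R]_n) : R :=
  Num.sqrt (\sum_(i < n) x ord0 i ^+ 2).

Definition eball (R : realType) (n : nat) (x : 'rV[R]_n) (r : R) :
    set 'rV[R]_n :=
  [set y | enorm (y - x) < r].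

Definition edist_set (R : realType) (n : nat) (x : 'rV[R]_n)
    (A : set 'rV[R]_n) : \bar R :=
  ereal_inf [set (enorm (x - y))%:E | y in A].

Definition boundary (T : topologicalType) (A : set T) : set T :=
  closure A `\` A°.

Definition domain (T : topologicalType) (A : set T) : Prop :=
  [/\ A !=set0, open A & connected A].

Definition partial (R : realType) (n : nat) (f : 'rV[R]_n -> R) (i : 'I_n)
    (x : 'rV[R]_n) : R :=
  'D_(delta_mx ord0 i) f x.

Definition grad (R : realType) (n : nat) (f : 'rV[R]_n -> R)
    (x : 'rV[R]_n) : 'cV[R]_n :=
  \col_i partial f i x.

Definition hessian (R : realType) (n : nat) (f : 'rV[R]_n -> R)
    (x : 'rV[R]_n) : 'M[R]_n :=
  \matrix_(i, j) partial (partial f j) i x.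

Definition C1_on (R : realType) (n : nat) (A : set 'rV[R]_n)
    (f : 'rV[R]_n -> R) : Prop :=
  {within A, continuous f} /\
  forall i : 'I_n,
    (forall x, A x -> derivable f x (delta_mx ord0 i)) /\
    {within A, continuous (partial f i)}.

Definition C2_on (R : realType) (n : nat) (A : set 'rV[R]_n)
    (f : 'rV[R]_n -> R) : Prop :=
  C1_on A f /\ forall i : 'I_n, C1_on A (partial f i).

Definition inf_laplacian (R : realType) (n : nat) (f : 'rV[R]_n -> R)
    (x : 'rV[R]_n) : R :=
  ((grad f x)^T *m hessian f x *m grad f x) ord0 ord0.

(* (v^+)^gamma; the case split fixes the value 0 where v <= 0, also for
   gamma = 0, whereas powR has 0 `^ 0 = 1. *)
Definition pos_pow (R : realType) (gamma v : R) : R :=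
  if 0 < v then v `^ gamma else 0.

Definition local_max (R : realType) (T : topologicalType) (f : T -> R)
    (y : T) : Prop :=
  \forall x \near y, f x <= f y.

Definition viscosity_subsolution (R : realType) (n : nat) (gamma : R)
    (Omega : set 'rV[R]_n) (u : 'rV[R]_n -> R) : Prop :=
  {within Omega, continuous u} /\
  forall (phi : 'rV[R]_n -> R) (y : 'rV[R]_n),
    C2_on Omega phi -> Omega y -> local_max (fun x => u x - phi x) y ->
    0 <= inf_laplacian phi y - pos_pow gamma (u y).

Definition viscosity_supersolution (R : realType) (n : nat) (gamma : R)
    (Omega : set 'rV[R]_n) (u : 'rV[R]_n -> R) : Prop :=
  {within Omega, continuous u} /\
  forall (phi : 'rV[R]_n -> R) (y : 'rV[R]_n),
    C2_on Omega phi -> Omega y -> local_max (fun x => phi x - u x) y ->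
    inf_laplacian phi y - pos_pow gamma (u y) <= 0.

Definition viscosity_solution (R : realType) (n : nat) (gamma : R)
    (Omega : set 'rV[R]_n) (u : 'rV[R]_n -> R) : Prop :=
  viscosity_subsolution gamma Omega u /\ viscosity_supersolution gamma Omega u.

(* Main.v *)
(* Comparison with a radial barrier. With b = 2 / (3 - gamma) and q = |x - y|^2,
   the function c (q + eps)^b is smooth even at y, and its infinity Laplacian is
   at most 8 b^3 (2b + 1) c^3 (q + eps)^(3b - 2), where 3b - 2 = b gamma; so for
   small c it is a strict supersolution for every eps > 0. Take y near X0 with
   u(y) > 0 and eps so small that the barrier at y is below u(y). If u were
   smaller than c rho^(2b) on the closed ball of radius rho around y, then u minus
   the barrier would attain its positive maximum in the interior, contradicting
   the subsolution property there. *)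

Require Import Defs.
From HB Require Import structures.
From mathcomp Require Import all_boot all_order all_algebra.
From mathcomp Require Import all_classical all_reals all_analysis.
From mathcomp Require Import ring lra.

Set Implicit Arguments.
Unset Strict Implicit.
Unset Printing Implicit Defensive.

Import Order.TTheory GRing.Theory Num.Theory.
Import numFieldNormedType.Exports.

Local Open Scope classical_set_scope.
Local Open Scope ring_scope.

(** * Chain rule and the squared Euclidean distance *)

Lemma is_derive_comp (R : realType) (V : normedModType R) (f : V -> R)
    (g : R -> R) (x v : V) (df dg : R) :
  differentiable f x -> is_derive x v f df -> is_derive (f x) 1 g dg ->
  is_derive x v (g \o f) (dg * df).
Proof.
move=> dfx fv gv.
have dgx : differentiable g (f x) by apply/derivable1_diffP.
have dgf : differentiable (g \o f) x by exact: differentiable_comp.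
apply: DeriveDef; first exact: diff_derivable.
rewrite deriveE// diff_comp//= -(deriveE _ dfx) (@derive_val _ _ _ _ _ _ _ fv).
by rewrite diff1E// derive1E (@derive_val _ _ _ _ _ _ _ gv) mulrC.
Qed.

(** A polynomial in the coordinates, so that smoothness and comparisons avoid the square root in
    [enorm]. *)
Definition sqdist (R : realType) (n : nat) (y x : 'rV[R]_n) : R :=
  \sum_(i < n) (x ord0 i - y ord0 i) ^+ 2.

(** A positive [eps] keeps the base of the power positive, also at [y]. The parameters [c] and [b]
    stay free because differentiation produces barriers with other coefficients and exponents. *)
Definition barrier (R : realType) (n : nat) (y : 'rV[R]_n) (eps c b : R)
    (x : 'rV[R]_n) : R :=
  c * (sqdist y x + eps) `^ b.

Lemma sqdist_ge0 (R : realType) (n : nat) (y x : 'rV[R]_n) :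
  0 <= sqdist y x.
Proof. by apply: sumr_ge0 => i _; exact: sqr_ge0. Qed.

Lemma is_derive_coordB (R : realType) (n : nat) (y x : 'rV[R]_n)
    (i j : 'I_n) :
  is_derive x (delta_mx ord0 j) (fun z : 'rV[R]_n => z ord0 i - y ord0 i)
    (i == j)%:R.
Proof.
apply: DeriveDef.
  apply: diff_derivable; apply: differentiableB => //.
  exact: differentiable_coord.
(* The difference quotient of an affine function is constant for nonzero [h]. *)
apply: cvg_lim => //; apply: cvg_near_cst.
near=> h.
rewrite /= !mxE eqxx /= opprB addrA subrK addrK.
rewrite [_ *: _]mulrA mulVf ?mul1r//.
by near: h; exact: nbhs_dnbhs_neq.
Unshelve. all: by end_near. Qed.

Lemma differentiable_sqdist (R : realType) (n : nat) (y x : 'rV[R]_n) :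
  differentiable (sqdist y) x.
Proof.
have -> : sqdist y =
    \sum_(i < n) (fun z : 'rV[R]_n => z ord0 i - y ord0 i) ^+ 2.
  by apply/funext => z; rewrite fct_sumE.
apply: differentiable_sum => i; apply: differentiableX.
by apply: differentiableB => //; exact: differentiable_coord.
Qed.

Lemma is_derive_sqdist (R : realType) (n : nat) (y x : 'rV[R]_n) (j : 'I_n) :
  is_derive x (delta_mx ord0 j) (sqdist y) (2 * (x ord0 j - y ord0 j)).
Proof.
have -> : sqdist y =
    \sum_(i < n) (fun z : 'rV[R]_n => z ord0 i - y ord0 i) ^+ 2.
  by apply/funext => z; rewrite fct_sumE.
(* Written as a sum with a Kronecker delta, the value has the shape given by the sum rule. *)
have -> : 2 * (x ord0 j - y ord0 j) =
    \sum_(i < n) (2%:R * (x ord0 i - y ord0 i) ^+ 1) *: ((i == j)%:R : R).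
  rewrite (bigD1 j)//= eqxx big1 ?addr0 => [|i /negPf ->].
    by rewrite [_ *: _]mulr1 expr1.
  by rewrite scaler0.
apply: is_derive_sum => i; apply: is_deriveX; exact: is_derive_coordB.
Qed.

(** * Smoothness and infinity Laplacian of the radial barrier *)

Section barrier.
Context (R : realType) (n : nat) (y : 'rV[R]_n) (eps : R).
Hypothesis eps_gt0 : 0 < eps.

Let q_gt0 x : 0 < sqdist y x + eps.
Proof. by rewrite ltr_wpDl ?sqdist_ge0. Qed.

Let differentiable_q x : differentiable (fun z => sqdist y z + eps) x.
Proof. by apply: differentiableD => //; exact: differentiable_sqdist. Qed.

Lemma differentiable_barrier (c b : R) x :
  differentiable (barrier y eps c b) x.
Proof.
rewrite (_ : barrier _ _ _ _ =
  c *: ((@powR R ^~ b) \o (fun z => sqdist y z + eps)))//.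
apply: differentiableZ; apply: differentiable_comp => //.
apply/derivable1_diffP.
by have := is_derive1_powR b (q_gt0 x); case.
Qed.

Lemma is_derive_barrier (c b : R) x j :
  is_derive x (delta_mx ord0 j) (barrier y eps c b)
    ((x ord0 j - y ord0 j) * barrier y eps (2 * b * c) (b - 1) x).
Proof.
have -> : barrier y eps c b =
  c *: ((@powR R ^~ b) \o (fun z => sqdist y z + eps)) by [].
have dq : is_derive x (delta_mx ord0 j) (fun z => sqdist y z + eps)
    (2 * (x ord0 j - y ord0 j)).
  rewrite -[X in is_derive _ _ _ X]addr0.
  by apply: is_deriveD; exact: is_derive_sqdist.
have := is_derive_comp (differentiable_q x) dq
  (is_derive1_powR b (q_gt0 x)).
move=> /(is_deriveZ c) /is_derive_eq; apply.
rewrite -[LHS]/(c * (b * (sqdist y x + eps) `^ (b - 1) *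
  (2 * (x ord0 j - y ord0 j)))) /barrier; ring.
Qed.

Lemma partial_barrier (c b : R) j :
  partial (barrier y eps c b) j =
  (fun x => (x ord0 j - y ord0 j) * barrier y eps (2 * b * c) (b - 1) x).
Proof. by apply/funext => x; have /@derive_val := is_derive_barrier c b x j. Qed.

Lemma is_derive_partial_barrier (c b : R) x i j :
  is_derive x (delta_mx ord0 i) (partial (barrier y eps c b) j)
   ((x ord0 j - y ord0 j) * (x ord0 i - y ord0 i) *
      barrier y eps (2 * (b - 1) * (2 * b * c)) (b - 1 - 1) x
    + (j == i)%:R * barrier y eps (2 * b * c) (b - 1) x).
Proof.
rewrite partial_barrier.
have := is_deriveM (is_derive_coordB y x j i)
  (is_derive_barrier (2 * b * c) (b - 1) x i).
move=> /is_derive_eq; apply; set B2 := barrier _ _ _ _ _; set B1 := barrier _ _ _ _ _.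
rewrite -[LHS]/((x ord0 j - y ord0 j) * ((x ord0 i - y ord0 i) * B2) +
  B1 * (j == i)%:R); ring.
Qed.

Let differentiable_coordB x j :
  differentiable (fun z : 'rV[R]_n => z ord0 j - y ord0 j) x.
Proof. by apply: differentiableB => //; exact: differentiable_coord. Qed.

(** Partial derivatives up to order two are sums of coordinate polynomials times barriers, hence
    differentiable and so continuous. *)
Lemma barrier_C2 (c b : R) (A : set 'rV[R]_n) :
  C2_on A (barrier y eps c b).
Proof.
have within f : (forall x, differentiable f x) -> {within A, continuous f}.
  move=> df; apply: continuous_subspaceT => x.
  exact: differentiable_continuous.
have dp j x : differentiable (partial (barrier y eps c b) j) x.
  rewrite partial_barrier; apply: differentiableM => //.
  exact: differentiable_barrier.
split; [split => [|i]|move=> j; split => [|i]].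
- by apply: within => x; exact: differentiable_barrier.
- split=> [x _|]; last exact: within.
  by apply: diff_derivable; exact: differentiable_barrier.
- exact: within.
- split=> [x _|]; first exact: diff_derivable.
  rewrite (_ : partial (partial _ _) _ = (fun x =>
    (x ord0 j - y ord0 j) * (x ord0 i - y ord0 i) *
      barrier y eps (2 * (b - 1) * (2 * b * c)) (b - 1 - 1) x
    + (j == i)%:R * barrier y eps (2 * b * c) (b - 1) x)).
    apply: within => x; apply: differentiableD.
      apply: differentiableM; last exact: differentiable_barrier.
      exact: differentiableM.
    apply: differentiableM => //; exact: differentiable_barrier.
  by apply/funext => x; have /@derive_val := is_derive_partial_barrier c b x i j.
Qed.

(** With [d = x - y], the gradient is [A d] and the Hessian is [A I + B d d^T], so the quadratic
    form equals [A^2 s (A + B s)]. *)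
Lemma inf_laplacian_barrier (c b : R) x :
  inf_laplacian (barrier y eps c b) x =
  8 * b ^+ 3 * c ^+ 3 * sqdist y x *
    (sqdist y x + eps) `^ (3 * b - 4) *
    (eps + (2 * b - 1) * sqdist y x).
Proof.
set d := fun i : 'I_n => x ord0 i - y ord0 i.
set A := barrier y eps (2 * b * c) (b - 1) x.
set B := barrier y eps (2 * (b - 1) * (2 * b * c)) (b - 1 - 1) x.
set s := sqdist y x.
have E : inf_laplacian (barrier y eps c b) x = A ^+ 2 * s * (A + B * s).
  rewrite /inf_laplacian mxE.
  transitivity (\sum_(j < n) (A ^+ 2 * (A + B * s)) * d j ^+ 2); last first.
    by rewrite -mulr_sumr -/(sqdist y x) -/s; ring.
  apply: eq_bigr => j _.
  have -> : (grad (barrier y eps c b) x) j ord0 = d j * A.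
    by rewrite mxE partial_barrier.
  rewrite mxE.
  transitivity ((\sum_(i < n) ((A * B * d j) * d i ^+ 2 +
     (j == i)%:R * (A ^+ 2 * d i))) * (d j * A)).
    congr (_ * _); apply: eq_bigr => i _.
    rewrite !mxE partial_barrier.
    have /@derive_val := is_derive_partial_barrier c b x i j.
    rewrite partial_barrier /partial => ->.
    rewrite -/A -/B -/(d i) -/(d j); ring.
  rewrite big_split/= -mulr_sumr -/(sqdist y x) -/s.
  rewrite (bigD1 j)//= eqxx mul1r big1 => [|i]; last first.
    by rewrite eq_sym => /negPf ->; rewrite mul0r.
  ring.
have q0 : sqdist y x + eps != 0 by rewrite gt_eqF.
rewrite E /A /B /barrier -/s -/s; set Q := s + eps.
have P (a e : R) : Q `^ (a + e) = Q `^ a * Q `^ e.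
  by rewrite powRD// q0 implybT.
(* With [Q^(b-2)] as common factor, [A + B s = 2 b c Q^(b-2) (Q + 2 (b-1) s)], and the last bracket
   is [eps + (2b-1) s]. *)
have -> : Q `^ (b - 1) = Q `^ (b - 2) * Q.
  by rewrite -[X in _ * X]powRr1 ?(ltW (q_gt0 x))// -P; congr powR; ring.
have -> : b - 1 - 1 = b - 2 by ring.
have -> : 3 * b - 4 = (b - 2) + (b - 2) + (b - 2) + 1 + 1 by ring.
rewrite !P powRr1 ?(ltW (q_gt0 x))//.
rewrite [in LHS]/Q [in RHS]/Q; ring.
Qed.

End barrier.

(** * Euclidean balls and their inclusion in the domain *)

Lemma enormB_lt (R : realType) (n : nat) (x y : 'rV[R]_n) (r : R) :
  0 < r -> (enorm (x - y) < r) = (sqdist y x < r ^+ 2).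
Proof.
move=> r0; rewrite -[in LHS](gtr0_norm r0) -sqrtr_sqr ltr_sqrt ?exprn_gt0//.
by congr (_ < _); apply: eq_bigr => i _; rewrite !mxE.
Qed.

Lemma sqdistC (R : realType) (n : nat) (x y : 'rV[R]_n) :
  sqdist x y = sqdist y x.
Proof. by apply: eq_bigr => i _; ring. Qed.

(** Convexity of the square in each coordinate; this serves as a triangle inequality without square
    roots. *)
Lemma sqdist_le2 (R : realType) (n : nat) (x y z : 'rV[R]_n) :
  sqdist x z <= 2 * sqdist x y + 2 * sqdist y z.
Proof.
rewrite !mulr_sumr -big_split/=; apply: ler_sum => i _.
set a := x _ _; set b := y _ _; set c := z _ _.
have := sqr_ge0 (a - b - (b - c)); nra.
Qed.

Lemma sqdistxx (R : realType) (n : nat) (x : 'rV[R]_n) : sqdist x x = 0.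
Proof. by apply: big1 => i _; rewrite subrr expr0n. Qed.

Lemma continuous_sqdist (R : realType) (n : nat) (y : 'rV[R]_n) :
  continuous (sqdist y).
Proof.
by move=> x; apply: differentiable_continuous; exact: differentiable_sqdist.
Qed.

(* A segment from [X0] that leaves [Omega] without meeting its boundary would be
   split by [Omega] into two relatively clopen pieces. *)
Lemma eball_sub_domain (R : realType) (n : nat) (Omega : set 'rV[R]_n)
    (X0 : 'rV[R]_n) (r : R) :
  open Omega -> Omega X0 -> 0 < r ->
  (r%:E < edist_set X0 (boundary Omega))%E -> eball X0 r `<=` Omega.
Proof.
move=> oO OX0 r0 rd z; rewrite /eball/= enormB_lt// => zr.
pose f (t : R) : 'rV[R]_n := X0 + t *: (z - X0).
pose S := f @` `[0, 1].
have cS : connected S.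
  apply: connected_continuous_connected; first exact: segment_connected.
  apply: continuous_subspaceT => t; apply: cvgD; first exact: cvg_cst.
  exact: scalel_continuous.
have fr t : t \in `[0, 1] -> sqdist (f t) X0 < r ^+ 2.
  rewrite in_itv/= => /andP[t0 t1]; apply: le_lt_trans zr.
  rewrite sqdistC.
  have -> : sqdist X0 (f t) = t ^+ 2 * sqdist X0 z.
    rewrite /sqdist mulr_sumr; apply: eq_bigr => i _; rewrite !mxE; ring.
  by rewrite ler_piMl ?sqdist_ge0// expr_le1.
have SO : S `&` Omega = S.
  apply: cS.
  - exists X0; split => //; exists 0; first by rewrite /= in_itv/= lexx ler01.
    by rewrite /f scale0r addr0.
  - by exists Omega.
  - exists (closure Omega); first exact: closed_closure.
    apply/seteqP; split => p [Sp Op]; split => //; first exact: subset_closure.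
    (* A point of the closure outside [Omega] would be a boundary point at distance less than [r]
       from [X0]. *)
    apply: contrapT => nOp; case: Sp => t t01 tp.
    have : (edist_set X0 (boundary Omega) <= (enorm (X0 - p))%:E)%E.
      apply: ereal_inf_lbound; exists p => //; split => //.
      by move=> /interior_subset.
    apply/negP; rewrite -ltNge; apply: lt_trans rd.
    by rewrite lte_fin enormB_lt// -tp fr.
have : S z.
  exists 1; first by rewrite /= in_itv/= lexx ler01.
  by rewrite /f scale1r addrC subrK.
by rewrite -SO => -[].
Qed.

(** * Comparison of a subsolution with the barrier *)

Lemma viscosity_subsolution_ge_on_ball (R : realType) (n : nat)
    (gamma b c rho : R) (Omega : set 'rV[R]_n) (u : 'rV[R]_n -> R)
    (y : 'rV[R]_n) :
  0 <= gamma -> 0 < b -> 0 < c ->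
  (forall eps x, 0 < eps -> inf_laplacian (barrier y eps c b) x <
     barrier y eps c b x `^ gamma) ->
  open Omega -> bounded_set Omega -> viscosity_subsolution gamma Omega u ->
  [set x | sqdist y x <= rho ^+ 2] `<=` Omega -> 0 < u y ->
  exists2 z, sqdist y z <= rho ^+ 2 & c * (rho ^+ 2) `^ b <= u z.
Proof.
move=> g0 b0 c0 super oO bO [cu subu] KO uy0.
set K := [set x | _] in KO.
apply: contrapT => nex.
have uK z : K z -> u z < c * (rho ^+ 2) `^ b.
  by move=> Kz; rewrite ltNge; apply/negP => uz; apply: nex; exists z.
(* This solves [c eps^b = u(y) / 2], so the barrier at [y] is half of [u y]. *)
pose eps := (u y / (2 * c)) `^ b^-1.
have eps0 : 0 < eps by rewrite powR_gt0// divr_gt0// mulr_gt0.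
set phi := barrier y eps c b.
have phiy : phi y < u y.
  rewrite /phi /barrier sqdistxx add0r /eps -powRrM mulVf ?gt_eqF// powRr1.
    have -> : c * (u y / (2 * c)) = u y / 2 by field; rewrite gt_eqF.
    by lra.
  by rewrite divr_ge0 ?mulr_ge0// ltW.
have Ky : K y by rewrite /K/= sqdistxx sqr_ge0.
have cK : compact K.
  apply: bounded_closed_compact.
    by case: bO => M [Mr bM]; exists M; split=> // N /bM h x /KO /h.
  rewrite /K -[X in closed X]/(sqdist y @^-1` [set t | t <= rho ^+ 2]).
  by apply: preimage_closed; [move=> x _; exact: continuous_sqdist|exact: closed_le].
have [x Kx maxx] : exists2 x, x \in K &
    forall t, t \in K -> u t - phi t <= u x - phi x.
  apply: (@EVT_max_rV _ _ (u - phi)) => //; first by exists y.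
  apply: within_continuousB; first exact: continuous_subspaceW cu.
  apply: continuous_subspaceT => z.
  exact/differentiable_continuous/differentiable_barrier.
move: Kx; rewrite inE => Kx.
have ux : phi x < u x.
  by have := maxx y; rewrite inE => /(_ Ky); lra.
have phi_gt0 : 0 < phi x by rewrite mulr_gt0// powR_gt0// ltr_wpDl ?sqdist_ge0.
(* Otherwise the barrier at [x] is at least [c (rho^2)^b], which exceeds [u x] by [uK], against
   [ux]. *)
have intx : sqdist y x < rho ^+ 2.
  rewrite ltNge; apply/negP => rx; have := uK x Kx; rewrite ltNge => /negP; apply.
  apply: le_trans (ltW ux); rewrite ler_pM2l// ge0_ler_powR ?(ltW b0)// ?nnegrE.
  - exact: sqr_ge0.
  - by rewrite addr_ge0 ?sqdist_ge0// ltW.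
  - by rewrite (le_trans rx)// lerDl ltW.
have lmax : local_max (fun z => u z - phi z) x.
  have : nbhs x (sqdist y @^-1` [set t | t < rho ^+ 2]).
    apply: open_nbhs_nbhs; split => //; apply: open_comp; last exact: open_lt.
    by move=> z _; exact: continuous_sqdist.
  by apply: filterS => z /= /ltW Kz; apply: maxx; rewrite inE.
have := subu phi x (barrier_C2 y eps0 c b Omega) (KO _ Kx) lmax.
(* As [u x > 0], the subsolution property bounds the infinity Laplacian of [phi] at [x] below by
   [u(x)^gamma]; but it is less than [phi(x)^gamma <= u(x)^gamma], since [gamma >= 0]. *)
rewrite /pos_pow (lt_trans phi_gt0 ux) subr_ge0; apply/negP; rewrite -ltNge.
apply: lt_le_trans (super eps x eps0) _.
by rewrite ge0_ler_powR ?nnegrE// ltW// (lt_trans phi_gt0).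
Qed.

(** * Choice of the barrier coefficient *)

(** Both sides are controlled by the same power of [Q], so one coefficient serves every dimension,
    centre and [eps]; this is what makes the final constant universal. *)
Lemma barrier_supersolution (R : realType) (gamma : R) :
  gamma < 3 ->
  exists2 c : R, 0 < c & forall n (y : 'rV[R]_n) eps x, 0 < eps ->
    inf_laplacian (barrier y eps c (2 / (3 - gamma))) x <
    barrier y eps c (2 / (3 - gamma)) x `^ gamma.
Proof.
move=> g3; set b := 2 / (3 - gamma).
have g3' : 0 < 3 - gamma by rewrite subr_gt0.
have b0 : 0 < b by rewrite divr_gt0.
(* This identity dictates [b]: it matches the exponents of [Q] on the two sides. *)
have bg : 3 * b - 2 = b * gamma by rewrite /b; field; lra.
clearbody b.
pose K := 8 * b ^+ 3 * (2 * b + 1).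
have K0 : 0 < K.
  by rewrite !mulr_gt0 ?exprn_gt0//; lra.
(* Chosen so that [K c^(3-gamma) = 1/2]; the factor 1/2 yields the strict inequality. *)
pose c := ((2 * K)^-1) `^ (3 - gamma)^-1.
have c0 : 0 < c by rewrite powR_gt0// invr_gt0 mulr_gt0.
have c3 : K * c ^+ 3 = 2^-1 * c `^ gamma.
  have -> : c ^+ 3 = c `^ (3 - gamma) * c `^ gamma.
    by rewrite -powRD ?(gt_eqF c0) ?implybT// subrK powR_mulrn// ltW.
  rewrite {1}/c -powRrM mulVf ?gt_eqF// powRr1; last first.
    by rewrite invr_ge0 ltW// mulr_gt0.
  by field; rewrite gt_eqF.
exists c => // n y eps x eps0; rewrite inf_laplacian_barrier//.
rewrite /barrier; set s := sqdist y x; set Q := s + eps.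
have s0 : 0 <= s by exact: sqdist_ge0.
have Q0 : 0 < Q by rewrite ltr_wpDl.
rewrite powRM ?powR_ge0 ?(ltW c0)// -powRrM -bg.
have -> : 3 * b - 2 = (3 * b - 4) + 1 + 1 by ring.
move: (3 * b - 4) => e; rewrite !powRD ?(gt_eqF Q0) ?implybT// powRr1 ?(ltW Q0)//.
have P0 : 0 < Q `^ e by rewrite powR_gt0.
set P := Q `^ _ in P0 *.
have h : s * (eps + (2 * b - 1) * s) <= (2 * b + 1) * Q ^+ 2.
  have sQ : s <= Q by rewrite lerDl ltW.
  (* The right side minus the left side is [2 b eps + 2 s]. *)
  have h1 : eps + (2 * b - 1) * s <= (2 * b + 1) * Q by rewrite /Q; nra.
  apply: le_trans (ler_wpM2l s0 h1) _.
  by rewrite expr2 mulrCA ler_pM2l ?ler_pM2r//; nra.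
apply: (@le_lt_trans _ _ (K * c ^+ 3 * P * Q ^+ 2)).
  have -> : K * c ^+ 3 * P * Q ^+ 2 =
      8 * b ^+ 3 * c ^+ 3 * P * ((2 * b + 1) * Q ^+ 2) by rewrite /K; ring.
  have -> : 8 * b ^+ 3 * c ^+ 3 * s * P * (eps + (2 * b - 1) * s) =
      8 * b ^+ 3 * c ^+ 3 * P * (s * (eps + (2 * b - 1) * s)) by ring.
  apply: ler_wpM2l h; apply/ltW; apply: mulr_gt0 => //.
  apply: mulr_gt0; last exact: exprn_gt0.
  by apply: mulr_gt0 => //; exact: exprn_gt0.
rewrite c3; have : 0 < c `^ gamma * (P * Q * Q).
  by apply: mulr_gt0; [exact: powR_gt0|do 2!apply: mulr_gt0 => //].
rewrite (_ : _ * P * _ = 2^-1 * (c `^ gamma * (P * Q * Q))); last by ring.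
by lra.
Qed.

(** * The growth estimate *)

Unset Implicit Arguments.

Theorem theorem6p1 (R : realType) (n : nat) (gamma : R)
    (Omega : set 'rV[R]_n) :
  (2 <= n)%N -> domain Omega -> bounded_set Omega ->
  0 <= gamma -> gamma < 3 ->
  exists c0 : R, 0 < c0 /\
    forall u : 'rV[R]_n -> R,
      {within Omega, continuous u} ->
      (forall x, Omega x -> 0 <= u x) ->
      viscosity_solution gamma Omega u ->
      forall X0 : 'rV[R]_n,
        (closure [set x | Omega x /\ 0 < u x] `&` Omega) X0 ->
        forall r : R, 0 < r -> (r%:E < edist_set X0 (boundary Omega))%E ->
          ((c0 * r `^ (4 / (3 - gamma)))%:E
             <= ereal_sup [set (u x)%:E | x in eball X0 r])%E.
Proof.
move=> _ [_ oO _] bO g0 g3.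
have [c c0 super] := barrier_supersolution g3.
have b0 : 0 < 2 / (3 - gamma) by rewrite divr_gt0// subr_gt0.
(* Comparison takes place on a ball of radius [r/2], which costs the factor [2^(-2b)] with
   [2b = 4 / (3 - gamma)]. *)
exists (c * 2^-1 `^ (4 / (3 - gamma))); split.
  by rewrite mulr_gt0// powR_gt0// invr_gt0.
move=> u _ _ [subu _] X0 [clX0 OX0] r r0 rd.
have BO := eball_sub_domain oO OX0 r0 rd.
have [y [[_ uy0]]] : [set x | Omega x /\ 0 < u x] `&`
    (sqdist X0 @^-1` [set t | t < (r / 4) ^+ 2]) !=set0.
  apply: clX0; apply: open_nbhs_nbhs; split.
    by apply: open_comp => [z _|]; [exact: continuous_sqdist|exact: open_lt].
  by rewrite /= sqdistxx exprn_gt0// divr_gt0.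
rewrite /= => yX0.
(* The radii fit because [2 (r/4)^2 + 2 (r/2)^2 = 5/8 r^2 < r^2]. *)
have near z : sqdist y z <= (r / 2) ^+ 2 -> eball X0 r z.
  rewrite /eball/= enormB_lt// => yz.
  by have := sqdist_le2 X0 y z; nra.
have [z yz uz] := viscosity_subsolution_ge_on_ball g0 b0 c0 (super n y) oO bO
  subu (fun z yz => BO z (near z yz)) uy0.
apply: (@le_trans _ _ (u z)%:E); last first.
  by apply: ereal_sup_ubound; exists z => //; exact: near.
rewrite lee_fin; apply: le_trans uz.
have rh0 : 0 <= r / 2 by rewrite divr_ge0// ltW.
rewrite -(powR_mulrn 2 rh0) -powRrM -mulrA -powRM ?invr_ge0 ?(ltW r0)//.
rewrite [2^-1 * r]mulrC mulrA.
by rewrite -[2%:R * 2]natrM.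
Qed.
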